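(* Let $\epsilon>0$, let $0<l_i\le u_i$, and let $\phi_i(x_i)=\sqrt{x_i}$ on $\mathbb{R}_+$. Let $\psi_i:\mathbb{R}_+\to\mathbb{R}_+$ be a piecewise-linear function (not necessarily continuous, and with pieces not necessarily tangent to the graph of $\phi_i$) that approximates $\phi_i$ to within a factor of $1+\epsilon$ on $[l_i,u_i]$. Then $\psi_i$ must contain at least $$\Bigl\lceil\tfrac13\log_{\gamma(\epsilon)}\tfrac{u_i}{l_i}\Bigr\rceil$$ pieces, where $\gamma(\epsilon)=\bigl(1+2\epsilon(2+\epsilon)+2(1+\epsilon)\sqrt{\epsilon(2+\epsilon)}\bigr)^2$. As $\epsilon\to0$ (with $l_i,u_i$ fixed), this lower bound behaves as $\frac{1}{\sqrt{288\epsilon}}\log\frac{u_i}{l_i}$, i.e. it equals $(1+o(1))\frac{1}{\sqrt{288\epsilon}}\log\frac{u_i}{l_i}$.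
   Context: $\mathbb{R}_+=[0,+\infty)$; $\log$ is the natural logarithm. A function $\psi_i:\mathbb{R}_+\to\mathbb{R}_+$ is piecewise-linear with $Q$ pieces if its domain can be partitioned into $Q$ intervals on each of which $\psi_i$ coincides with an affine function $f+sx$; no continuity is required. $\psi_i$ approximates $\phi_i$ on $[l_i,u_i]$ to within a factor of $1+\epsilon$ if $\frac{1}{1+\epsilon}\le\frac{\psi_i(x_i)}{\phi_i(x_i)}\le1+\epsilon$ for all $x_i\in[l_i,u_i]$. *)

(* Defs.v *)
From HB Require Import structures.
From mathcomp Require Export all_boot all_order all_algebra.
From mathcomp Require Export all_classical all_reals all_analysis.
Export Order.TTheory GRing.Theory Num.Theory.
Export numFieldNormedType.Exports.
Set Implicit Arguments.
Unset Strict Implicit.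
Unset Printing Implicit Defensive.

Local Open Scope classical_set_scope.
Local Open Scope ring_scope.

(* Functions on [0, +oo[ are represented by functions R -> R of which only the
   restriction to [0, +oo[ matters. *)

(* The Q intervals may be open, closed, half-open, or reduced to a point, and
   psi may jump at their endpoints. *)
Definition piecewise_linear (R : realType) (psi : R -> R) (Q : nat) : Prop :=
  exists I : 'I_Q -> interval R,
    partition [set: 'I_Q] (fun i => [set` I i]) `[0, +oo[ /\
    forall i, exists f s : R, forall x, x \in I i -> psi x = f + s * x.

Definition approximates (R : realType) (psi phi : R -> R) (l u eps : R) : Prop :=
  forall x, x \in `[l, u] -> 1 / (1 + eps) <= psi x / phi x <= 1 + eps.

Definition logb (R : realType) (b x : R) : R := ln x / ln b.

Definition gamma (R : realType) (eps : R) : R :=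
  (1 + 2 * eps * (2 + eps)
   + 2 * (1 + eps) * Num.sqrt (eps * (2 + eps))) ^+ 2.

Definition pieces_lower_bound (R : realType) (l u eps : R) : int :=
  Num.ceil (3^-1 * logb (gamma eps) (u / l)).

(* Main.v *)
(** On a piece through [a] and [b], the line lies below the chord of the concave
    function [(1 + eps) * sqrt] over [[a, b]] and, at the geometric mean of [a]
    and [b], above [sqrt / (1 + eps)]; this forces [b <= gamma eps ^+ 2 * a].
    If [gamma eps ^+ (3 * Q) <= u / l], then by pigeonhole two of the [Q + 1]
    points [l * gamma eps ^+ (3 * k)] share a piece, although their ratio is at
    least [gamma eps ^+ 3].  The asymptotics come from
    [gamma eps = (1 + w) ^+ 4] with [w] equivalent to [sqrt (2 * eps)]. *)
Require Import Defs.
From mathcomp Require Import ring lra.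

Set Implicit Arguments.
Unset Strict Implicit.
Unset Printing Implicit Defensive.

Local Open Scope classical_set_scope.
Local Open Scope ring_scope.

(** * The ratio spanned by one affine piece *)

Definition sqrt_gamma (R : realType) (eps : R) : R :=
  1 + 2 * eps * (2 + eps) + 2 * (1 + eps) * Num.sqrt (eps * (2 + eps)).

Lemma sqrt_gamma_gt1 (R : realType) (eps : R) : 0 < eps -> 1 < sqrt_gamma eps.
Proof.
move=> e0; rewrite /sqrt_gamma.
have := sqrtr_ge0 (eps * (2 + eps)); set y := Num.sqrt _ => y0.
nra.
Qed.

Lemma gamma_gt1 (R : realType) (eps : R) : 0 < eps -> 1 < gamma eps.
Proof. by move=> e0; rewrite exprn_egt1// sqrt_gamma_gt1. Qed.

(** With [k = 2 * (1 + eps) ^+ 2 - 1], [sqrt_gamma eps] is [k + Num.sqrt (k ^+ 2 - 1)], the larger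
    root of the reciprocal polynomial [t ^+ 2 - 2 * k * t + 1]. *)
Lemma sqrt_gamma_root (R : realType) (eps : R) : 0 < eps ->
  sqrt_gamma eps ^+ 2 = 2 * (2 * (1 + eps) ^+ 2 - 1) * sqrt_gamma eps - 1.
Proof.
move=> e0; have e1 : 0 <= eps * (2 + eps) by nra.
rewrite /sqrt_gamma.
have := sqr_sqrtr e1; set y := Num.sqrt _ => yE.
ring: yE.
Qed.

(** For [D = sqrt_gamma eps] the two roots are [D] and [D^-1], so
    [p ^+ 2 + q ^+ 2 - 2 * k * (p * q)] factors as [(q - D * p) * (q - D^-1 * p)], which is positive
    once [q > D * p]. This contradicts the hypothesis, because [(1 + eps) ^+ 2 <= k]. *)
Lemma le_sqrt_gamma_mul (R : realType) (eps p q : R) : 0 < eps -> 0 < p ->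
  p ^+ 2 + q ^+ 2 <= 2 * (1 + eps) ^+ 2 * (p * q) -> q <= sqrt_gamma eps * p.
Proof.
move=> e0 p0 H; rewrite leNgt; apply/negP => ltq.
have D1 := sqrt_gamma_gt1 e0; have DE := sqrt_gamma_root e0.
set D := sqrt_gamma eps in D1 DE ltq *.
have pDp : p < D * p by rewrite ltr_pMl.
have pos : 0 < (q - D * p) * (D * q - p).
  by rewrite mulr_gt0 ?subr_gt0//; nra.
have E : (q - D * p) * (D * q - p) =
    D * (p ^+ 2 + q ^+ 2 - 2 * (2 * (1 + eps) ^+ 2 - 1) * (p * q)).
  ring: DE.
move: pos; rewrite E pmulr_rgt0; last by lra.
have pq : 0 < p * q by rewrite mulr_gt0//; lra.
have : 0 <= ((1 + eps) ^+ 2 - 1) * (p * q) by apply: mulr_ge0; nra.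
lra.
Qed.

Lemma affine_sqrt_ratio (R : realType) (eps f s a b : R) :
  0 < eps -> 0 < a -> a <= b ->
  (forall x, a <= x <= b ->
    1 / (1 + eps) <= (f + s * x) / Num.sqrt x <= 1 + eps) ->
  b <= gamma eps ^+ 2 * a.
Proof.
move=> e0 a0 ab H.
have b0 := lt_le_trans a0 ab.
(* With fourth roots, the square roots of [a], [b] and of their geometric mean are [p ^+ 2],
   [q ^+ 2] and [p * q], so all constraints become polynomial. *)
pose p := Num.sqrt (Num.sqrt a); pose q := Num.sqrt (Num.sqrt b).
have p0 : 0 < p by rewrite !sqrtr_gt0.
have q0 : 0 < q by rewrite !sqrtr_gt0.
have pq : p <= q by rewrite !ler_wsqrtr.
have aE : a = (p ^+ 2) ^+ 2 by rewrite !sqr_sqrtr ?sqrtr_ge0// ltW.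
have bE : b = (q ^+ 2) ^+ 2 by rewrite !sqr_sqrtr ?sqrtr_ge0// ltW.
clearbody p q; subst a b.
have sq z : 0 < z -> Num.sqrt (z ^+ 2) = z by move=> z0; rewrite sqrtr_sqr gtr0_norm.
have p2 : 0 < p ^+ 2 by rewrite exprn_gt0.
have q2 : 0 < q ^+ 2 by rewrite exprn_gt0.
have pq0 : 0 < p * q by rewrite mulr_gt0.
have /andP[_] : 1 / (1 + eps) <= (f + s * (p ^+ 2) ^+ 2) / Num.sqrt ((p ^+ 2) ^+ 2) <= 1 + eps.
  by apply: H; rewrite lexx.
rewrite sq// ler_pdivrMr// => Ha.
have /andP[_] : 1 / (1 + eps) <= (f + s * (q ^+ 2) ^+ 2) / Num.sqrt ((q ^+ 2) ^+ 2) <= 1 + eps.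
  by apply: H; rewrite lexx andbT.
rewrite sq// ler_pdivrMr// => Hb.
have /andP[+ _] : 1 / (1 + eps) <= (f + s * (p * q) ^+ 2) / Num.sqrt ((p * q) ^+ 2) <= 1 + eps.
  apply: H; rewrite -!exprM exprMn (_ : 2 * 2 = 2 + 2)%N// !exprD.
  by rewrite ler_pM2l// ler_pM2r// !lerXn2r// nnegrE ltW.
rewrite sq// ler_pdivlMr// mulrAC ler_pdivrMr ?mul1r; last by lra.
move=> Hm.
have qD : q <= sqrt_gamma eps * p.
  apply: le_sqrt_gamma_mul => //.
  rewrite -(ler_pM2r pq0).
  (* [(p * q) ^+ 2] is the barycentre of [p ^+ 4] and [q ^+ 4] with weights
     [q ^+ 2] and [p ^+ 2]. *)
  have Hc : (p ^+ 2 + q ^+ 2) * (f + s * (p * q) ^+ 2)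
      <= 2 * (1 + eps) * (p * q) ^+ 2.
    have := lerD (ler_wpM2l (ltW q2) Ha) (ler_wpM2l (ltW p2) Hb).
    by congr (_ <= _); ring.
  have s2 : 0 < p ^+ 2 + q ^+ 2 by rewrite addr_gt0.
  apply: (le_trans (ler_wpM2l (ltW s2) Hm)).
  have e1 : 0 <= 1 + eps by lra.
  by have := ler_wpM2r e1 Hc; congr (_ <= _); ring.
have -> : gamma eps ^+ 2 * (p ^+ 2) ^+ 2 = ((sqrt_gamma eps * p) ^+ 2) ^+ 2.
  by rewrite /gamma -/(sqrt_gamma eps); ring.
have D0 : 0 < sqrt_gamma eps by apply: lt_trans (sqrt_gamma_gt1 e0).
by rewrite !lerXn2r// nnegrE ?exprn_ge0// ltW// mulr_gt0.
Qed.

(** * Counting the pieces *)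

Lemma cover_pigeonhole (T : Type) (Q : nat) (A : 'I_Q -> set T) (x : nat -> T) :
  (forall k, (k <= Q)%N -> exists i, A i (x k)) ->
  exists i j n, [/\ (i < j)%N, (j <= Q)%N, A n (x i) & A n (x j)].
Proof.
move=> H.
have /choice[g gP] : forall k : 'I_Q.+1, exists i, A i (x k).
  by move=> k; apply: H; rewrite -ltnS.
have /injectivePn[i [j ij gij]] : ~~ injectiveb g.
  apply/negP => /injectiveP /leq_card.
  by rewrite !card_ord ltnn.
wlog lij : i j ij gij / (i < j)%N.
  move=> W; have [|] := ltnP i j; first exact: W.
  rewrite leq_eqVlt => /orP[/eqP /val_inj ji|]; last by apply: W; rewrite // eq_sym.
  by rewrite ji eqxx in ij.
exists i, j, (g i); split => //; first by rewrite -ltnS.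
by rewrite gij.
Qed.

Lemma piecewise_linear_sqrt_ratio (R : realType) (l u eps : R) (psi : R -> R)
    (Q : nat) : 0 < l -> 0 < eps -> piecewise_linear psi Q ->
  approximates psi (fun x => Num.sqrt x) l u eps ->
  u / l < (gamma eps ^+ 3) ^+ Q.
Proof.
move=> l0 e0 [I [[cov _ _] lin]] app.
rewrite ltNge; apply/negP; rewrite ler_pdivlMr// => leu.
have g1 := gamma_gt1 e0; have g0 : 0 < gamma eps by apply: lt_trans g1.
set c := gamma eps ^+ 3 in leu.
have c1 : 1 < c by rewrite exprn_egt1.
(* These points start at [l], and [leu] says exactly that [x Q <= u]. *)
pose x k := c ^+ k * l.
have x0 k : 0 < x k by rewrite mulr_gt0// exprn_gt0// (lt_trans _ c1).
have xmono i j : (i <= j)%N -> x i <= x j.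
  by move=> ij; rewrite ler_pM2r// ler_eXn2l.
have [|i [j [n [ij jQ xi xj]]]] :=
    @cover_pigeonhole _ Q (fun i => [set` I i]) x.
  move=> k _.
  have : [set` `[0, +oo[] (x k) by rewrite /= in_itv /= andbT ltW.
    by rewrite -cov => -[i _ xi]; exists i.
have [f [s fs]] := lin n.
have : x j <= gamma eps ^+ 2 * x i.
  apply: (@affine_sqrt_ratio _ _ f s) => //; first exact/xmono/ltnW.
  move=> y /andP[iy yj].
  (* A piece is convex, so the same affine formula holds on the whole of [[x i, x j]]. *)
  have yI : y \in I n.
    by apply: (interval_is_interval xi xj); rewrite iy yj.
  rewrite -(fs _ yI); apply: app; rewrite in_itv /=; apply/andP; split.
    by apply: le_trans iy; rewrite ler_peMl ?(ltW l0)// exprn_ege1// ltW.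
  by apply: (le_trans yj); apply: le_trans leu; apply: xmono.
(* Already [x i.+1 = gamma eps ^+ 3 * x i] exceeds [gamma eps ^+ 2 * x i]. *)
apply/negP; rewrite -ltNge; apply: lt_le_trans (xmono _ _ ij).
have -> : x i.+1 = c * x i by rewrite /x exprS mulrA.
by rewrite ltr_pM2r ?x0// ltr_eXn2l.
Qed.

Lemma pieces_lower_bound_le (R : realType) (l u eps : R) (Q : nat) :
  0 < l -> 0 < u -> 0 < eps -> u / l <= (gamma eps ^+ 3) ^+ Q ->
  pieces_lower_bound l u eps <= Q%:Z.
Proof.
move=> l0 u0 e0 H.
have g1 := gamma_gt1 e0.
have g0 : 0 < gamma eps by apply: lt_trans g1.
rewrite /pieces_lower_bound ceil_le_int /logb.
rewrite mulrA ler_pdivrMr ?ln_gt0//.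
have : ln (u / l) <= ln (gamma eps ^+ (3 * Q)).
  rewrite -exprM in H.
  by rewrite ler_ln// posrE ?divr_gt0//; exact: exprn_gt0.
rewrite lnXn// -[X in _ <= X]mulr_natl natrM; set G := ln _.
by rewrite -pmulrn; lra.
Qed.

(** * Asymptotics as [eps] tends to 0 *)

(* [sqrt_ratio eps = w / Num.sqrt (2 * eps)] where [gamma eps = (1 + w) ^+ 4]. *)
Definition sqrt_ratio (R : realType) (eps : R) : R :=
  Num.sqrt (eps / 2) + Num.sqrt (1 + eps / 2).

(** Here [w = eps + Num.sqrt (eps * (2 + eps))], and [sqrt_gamma eps] is itself the square of
    [1 + w]. *)
Lemma gammaE (R : realType) (eps : R) : 0 < eps ->
  gamma eps = (1 + Num.sqrt (2 * eps) * sqrt_ratio eps) ^+ 4.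
Proof.
move=> e0; rewrite /gamma /sqrt_ratio.
have -> : Num.sqrt (2 * eps) * (Num.sqrt (eps / 2) + Num.sqrt (1 + eps / 2))
    = eps + Num.sqrt (eps * (2 + eps)).
  rewrite mulrDr -!sqrtrM; [|lra..].
  rewrite (_ : 2 * eps * (eps / 2) = eps ^+ 2); last by field.
  by rewrite sqrtr_sqr gtr0_norm//; congr (_ + Num.sqrt _); field.
have e1 : 0 <= eps * (2 + eps) by nra.
have := sqr_sqrtr e1; set y := Num.sqrt _ => yE.
rewrite -[4%N]/(2 * 2)%N exprM; congr (_ ^+ 2).
ring: yE.
Qed.

Lemma sqrt_ratio_ge1 (R : realType) (eps : R) : 0 < eps -> 1 <= sqrt_ratio eps.
Proof.
move=> e0; rewrite /sqrt_ratio.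
have : 1 <= Num.sqrt (1 + eps / 2) by rewrite -{1}sqrtr1 ler_wsqrtr//; lra.
have := sqrtr_ge0 (eps / 2); lra.
Qed.

(** Since [288 = 12 ^+ 2 * 2] and [ln (gamma eps) = 4 * ln (1 + w)], the middle term is
    [Num.sqrt (2 * eps) / ln (1 + w)]; the bounds come from [w / (1 + w) <= ln (1 + w) <= w]. *)
Lemma ln_gamma_bounds (R : realType) (eps : R) : 0 < eps ->
  (sqrt_ratio eps)^-1 <= Num.sqrt (288 * eps) / (3 * ln (gamma eps))
    <= (sqrt_ratio eps)^-1 + Num.sqrt (2 * eps).
Proof.
move=> e0; have p1 := sqrt_ratio_ge1 e0.
have p0 : 0 < sqrt_ratio eps by apply: lt_le_trans p1.
have -> : Num.sqrt (288 * eps) = 12 * Num.sqrt (2 * eps).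
  rewrite (_ : 288 * eps = 12 ^+ 2 * (2 * eps)); last by ring.
  by rewrite sqrtrM ?sqrtr_sqr ?ger0_norm// exprn_ge0.
rewrite gammaE//.
have t0 : 0 < Num.sqrt (2 * eps) by rewrite sqrtr_gt0 mulr_gt0.
move: (sqrt_ratio eps) (Num.sqrt _) p0 t0 => p t p0 t0.
have w0 : 0 < t * p by rewrite mulr_gt0.
have w1 : 0 < 1 + t * p by lra.
rewrite lnXn//.
have L1 : ln (1 + t * p) <= t * p by apply: le_ln1Dx; lra.
have L0 : 0 < ln (1 + t * p) by rewrite ln_gt0//; lra.
(* [ln v <= v - 1] at [v = 1 / (1 + w)] *)
have L2 : t * p / (1 + t * p) <= ln (1 + t * p).
  have : ln (1 + ((1 + t * p)^-1 - 1)) <= (1 + t * p)^-1 - 1.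
    by apply: le_ln1Dx; rewrite ltrBrDr addNr invr_gt0.
  rewrite addrC subrK lnV ?posrE// => H.
  have -> : t * p / (1 + t * p) = 1 - (1 + t * p)^-1 by field; lra.
  lra.
move: (ln _) L0 L1 L2 => L L0 L1; rewrite ler_pdivrMr// => L2.
have -> : 12 * t / (3 * (L *+ 4)) = t / L by field; rewrite gt_eqF.
have -> : p^-1 + t = (1 + t * p) / p by field; rewrite gt_eqF.
rewrite ler_pdivlMr// mulrC ler_pdivrMr// L1 /=.
rewrite ler_pdivlMr// mulrAC ler_pdivrMr//; lra.
Qed.

Lemma pieces_lower_bound_asymptotics (R : realType) (l u : R) : 1 < u / l ->
  (pieces_lower_bound l u eps)%:~R * Num.sqrt (288 * eps) / ln (u / l) - 1
    @[eps --> 0^'+] --> (0 : R).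
Proof.
move=> ul; have L0 := ln_gt0 ul; set L := ln _ in L0 *.
have csqrt (c d : R) : Num.sqrt (c + d * eps) @[eps --> 0^'+] --> Num.sqrt c.
  have -> : Num.sqrt c = Num.sqrt (c + d * 0) by rewrite mulr0 addr0.
  apply: cvg_at_right_filter.
  apply: (@continuous_comp _ _ _ (fun x => c + d * x) Num.sqrt); last exact: sqrt_continuous.
  by apply: cvgD; [exact: cvg_cst|apply: cvgMr; exact: cvg_id].
have csqrt0 (d : R) : Num.sqrt (d * eps) @[eps --> 0^'+] --> (0 : R).
  rewrite -[X in _ --> X]sqrtr0; have := csqrt 0 d.
  by under eq_fun do rewrite add0r.
have cp : (sqrt_ratio eps)^-1 @[eps --> 0^'+] --> (1 : R).
  rewrite -[X in _ --> X]invr1; apply: cvgV; first exact: oner_neq0.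
  rewrite -[X in _ --> X]add0r -sqrtr1; apply: cvgD.
    by under eq_fun do rewrite mulrC; exact: csqrt0.
  by under eq_fun do rewrite mulrC; exact: csqrt.
(* Rounding up adds at most 1 to the count, hence the extra term [Num.sqrt (288 * eps) / L] in the
   upper function. *)
apply: (@squeeze_cvgr _ _ _ _ (fun eps => (sqrt_ratio eps)^-1 - 1)
  (fun eps => (sqrt_ratio eps)^-1 + Num.sqrt (2 * eps)
     + Num.sqrt (288 * eps) / L - 1)); last 2 first.
- rewrite -[X in _ --> X](subrr 1); apply: cvgB => //; exact: cvg_cst.
- rewrite [X in _ --> X](_ : 0 = 1 + 0 + 0 / L - 1); last by rewrite mul0r; ring.
  apply: cvgB; last exact: cvg_cst.
  apply: cvgD; first exact: (cvgD cp (csqrt0 2)).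
  exact: (cvgMl (csqrt0 288)).
near=> eps.
have e0 : 0 < eps by near: eps; exact: nbhs_right_gt.
have /andP[lo hi] := ln_gamma_bounds e0.
have G0 : 0 < ln (gamma eps) by rewrite ln_gt0// gamma_gt1.
rewrite /pieces_lower_bound /logb -/L.
set X := 3^-1 * (L / ln (gamma eps)).
(* Before rounding, the normalised bound does not depend on [L]: it is the middle term of
   [ln_gamma_bounds]. *)
have XE : Num.sqrt (288 * eps) / (3 * ln (gamma eps)) = X * Num.sqrt (288 * eps) / L.
  by rewrite /X; field; rewrite !gt_eqF.
rewrite XE in lo hi; clearbody X.
rewrite -!mulrA in lo hi *.
have : 0 <= Num.sqrt (288 * eps) / L by rewrite divr_ge0 ?sqrtr_ge0// ltW.
move: (Num.sqrt (288 * eps) / L) lo hi => S lo hi S0.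
have c1 : X <= (Num.ceil X)%:~R by exact: ceil_ge.
have c2 : (Num.ceil X)%:~R <= X + 1 by have := @ceilB1_lt R X; lra.
have := ler_wpM2r S0 c1; have := ler_wpM2r S0 c2; rewrite mulrDl mul1r => ? ?.
apply/andP; split; lra.
Unshelve. all: by end_near.
Qed.

Theorem theorem2 (R : realType) (l u : R) (l_gt0 : 0 < l) (le_lu : l <= u) :
  (forall (eps : R) (psi : R -> R) (Q : nat),
     0 < eps ->
     (forall x : R, 0 <= x -> 0 <= psi x) ->
     piecewise_linear psi Q ->
     approximates psi (fun x => Num.sqrt x) l u eps ->
     pieces_lower_bound l u eps <= Q%:Z) /\
  (exists o : R -> R,
     o eps @[eps --> 0^'+] --> 0 /\
     forall eps : R, 0 < eps ->
       (pieces_lower_bound l u eps)%:~R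
       = (1 + o eps) * (1 / Num.sqrt (288 * eps) * ln (u / l))).
Proof.
have u_gt0 := lt_le_trans l_gt0 le_lu.
split=> [eps psi Q e0 _ lin app|].
  have := piecewise_linear_sqrt_ratio l_gt0 e0 lin app.
  by move/ltW; exact: pieces_lower_bound_le.
(* If [l = u], both sides vanish and the zero function serves as [o]; the quotient used for [l < u]
   would divide by [ln 1 = 0] and be constantly -1. *)
have [lu|lu|<-] := ltgtP l u; last 1 first.
- exists (fun=> 0); split=> [|eps e0]; first exact: cvg_cst.
  rewrite /pieces_lower_bound /logb divff ?gt_eqF// ln1.
  by rewrite mul0r !mulr0 ceil0.
- have ul : 1 < u / l by rewrite ltr_pdivlMr// mul1r.
  eexists; split; first exact: (pieces_lower_bound_asymptotics ul).
  move=> eps e0 /=; field.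
  by rewrite !gt_eqF ?ln_gt0// sqrtr_gt0 mulr_gt0.
- by move: le_lu; rewrite leNgt lu.
Qed.
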